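(* Let $\gamma>-1$, let $n\ge0$, and let $\{(\xi_j,\lambda_j)\}_{j=1}^N$ be any positive cubature formula on $(V,\nu_\gamma)$ exact on $\Pi_{2n}(V)$. Put $D_n=(n+1)^2$. Then for every $p\in\Pi_n^{\mathbb{C}}(V)$, $$\sum_{j=1}^N\lambda_j|p(\xi_j)|^2=\|p\|_{L^2(\nu_\gamma)}^2 .$$ Let $\{P_\ell\}_{\ell=1}^{D_n}$ be any orthonormal basis of $\Pi_n^{\mathbb{C}}(V)$ in $L^2(\nu_\gamma)$ and define the $N\times D_n$ matrix $\mathrm S_{j\ell}=\sqrt{\lambda_j}\,P_\ell(\xi_j)$. Then $$\mathrm S^*\mathrm S=I_{D_n},\qquad \kappa_2(\mathrm S)=1 .$$ For a sample vector $a=(a_j)_{j=1}^N\in\mathbb{C}^N$ set $$\|a\|_{\ell^2_\lambda}=\Big(\sum_j\lambda_j|a_j|^2\Big)^{1/2},\qquad Ta=\sum_j\lambda_ja_jK_n^V(\,\cdot\,,\xi_j).$$ Then $\|T\|_{\ell^2_\lambda\to L^2(\nu_\gamma)}=1$.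
   Context: $V=\{(x,y,t)\in\mathbb{R}^3:x^2+y^2=t^2,\ 0\le t\le1\}$, parametrized by $(x,y,t)=(t\cos\phi,t\sin\phi,t)$, with the probability measure $d\nu_\gamma(t,\phi)=\frac{\gamma+1}{2\pi}(1-t)^\gamma\,dt\,d\phi$ on $0\le t\le1$, $0\le\phi<2\pi$. $\Pi_m(V)$ is the space of restrictions to $V$ of polynomials in three real variables of total degree at most $m$; $\Pi_m^{\mathbb{C}}(V)$ is its complexification; its dimension is $(m+1)^2$. A positive cubature formula is a finite set of distinct nodes $\xi_j\in V$ with strictly positive weights $\lambda_j$; it is exact on $\Pi_{2n}(V)$ if $\sum_j\lambda_jp(\xi_j)=\int_Vp\,d\nu_\gamma$ for all $p\in\Pi_{2n}(V)$. $K_n^V$ is the reproducing kernel of $\Pi_n^{\mathbb{C}}(V)$ in $L^2(\nu_\gamma)$: $K_n^V(\eta,\xi)=\sum_{\ell=1}^{D_n}P_\ell(\eta)\overline{P_\ell(\xi)}$, so that $p(\xi)=\langle p,K_n^V(\cdot,\xi)\rangle$ with $\langle f,g\rangle=\int_Vf\overline g\,d\nu_\gamma$. $\kappa_2$ is the $2$-norm condition number (ratio of largest to smallest singular value). *)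

(* Defs.v *)
From HB Require Import structures.
From mathcomp Require Import all_boot all_order all_algebra complex.
(* The notations of mpoly clash with those of the analysis library, and its
   isMeasure would shadow the one of measure theory if imported later. *)
From mathcomp Require mpoly.
Import -(notations) mpoly.
From mathcomp Require Import all_classical all_reals all_analysis.
From mathcomp Require Import measurable_realfun.
Set Implicit Arguments.
Unset Strict Implicit.
Unset Printing Implicit Defensive.
Import Order.TTheory GRing.Theory Num.Theory.
Import numFieldNormedType.Exports.
Local Open Scope classical_set_scope.
Local Open Scope ring_scope.
Local Open Scope sesquilinear_scope.

Notation normc := ComplexField.Normc.normc.

Notation space3 R :=
  (R * R * R)%type.

Section cone.
Context {R : realType}.
Local Notation C := R[i].
Local Notation space := (space3 R).

Definition cone : set space :=
  [set z | z.1.1 ^+ 2 + z.1.2 ^+ 2 = z.2 ^+ 2 /\ 0 <= z.2 <= 1].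

Definition cone_param (z : R * R) : space :=
  (z.1 * cos z.2, z.1 * sin z.2, z.1).

Definition cone_density (gamma : R) (z : R * R) : R :=
  (gamma + 1) / (2 * pi) * (1 - z.1) `^ gamma.

Definition param_measure (gamma : R) (A : set (R * R)) : \bar R :=
  (\int[lebesgue_measure \x lebesgue_measure]_(z in
     A `&` (`[0%R, 1%R] `*` `[0%R, (2 * pi)%R[)) (cone_density gamma z)%:E)%E.

(* The hypothesis on gamma is only used to make the density nonnegative. *)
Definition cone_measure (gamma : R) (hgamma : -1 < gamma) :
  set space -> \bar R := pushforward (param_measure gamma) cone_param.

Lemma cone_density_ge0 gamma : -1 < gamma -> forall z, 0 <= cone_density gamma z.
Proof.
move=> hg z; rewrite /cone_density mulr_ge0 ?powR_ge0// divr_ge0 ?mulr_ge0 ?pi_ge0//.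
by rewrite -lerBlDr sub0r ltW.
Qed.

Lemma measurable_cone_density gamma : measurable_fun setT (cone_density gamma).
Proof.
apply: measurable_funM => //.
apply: (measurableT_comp (measurable_powR gamma)).
by apply: measurable_funB => //; exact: measurable_fst.
Qed.

Lemma measurable_cone_param : measurable_fun setT cone_param.
Proof.
apply: measurable_fun_pair => /=; last exact: measurable_fst.
have mc : measurable_fun setT (@cos R).
  by apply: continuous_measurable_fun; exact: continuous_cos.
have ms : measurable_fun setT (@sin R).
  by apply: continuous_measurable_fun; exact: continuous_sin.
apply: measurable_fun_pair => /=; apply: measurable_funM.
- exact: measurable_fst.
- exact: (measurableT_comp mc measurable_snd).
- exact: measurable_fst.
- exact: (measurableT_comp ms measurable_snd).
Qed.

Section measure_instance.
Variables (gamma : R) (hgamma : -1 < gamma).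
Local Notation nu := (cone_measure hgamma).

Let nu0 : nu set0 = 0%E.
Proof.
by rewrite /cone_measure /pushforward preimage_set0 /param_measure set0I
  integral_set0.
Qed.

Let nu_ge0 A : (0 <= nu A)%E.
Proof. by apply: integral_ge0 => z _; rewrite lee_fin cone_density_ge0. Qed.

Let nu_sigma_additive : semi_sigma_additive nu.
Proof.
move=> F mF tF mUF; apply: cvg_toP.
  apply: ereal_nondecreasing_is_cvgn => m k mk.
  by apply: lee_sum_nneg_natr => // ? _ _; exact: nu_ge0.
rewrite /cone_measure /pushforward /param_measure preimage_bigcup setI_bigcupl.
rewrite ge0_integral_bigcup//=.
- move=> k; apply: measurableI; last by apply: measurableX.
  by rewrite -[X in measurable X]setTI; exact: measurable_cone_param.
- apply/measurable_funTS/measurableT_comp => //.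
  exact: measurable_cone_density.
- by move=> z _; rewrite lee_fin cone_density_ge0.
- by move=> i j _ _ [z [[Fi _] [Fj _]]]; apply: tF => //; exists (cone_param z).
Qed.

HB.instance Definition _ := isMeasure.Build _ _ _ nu nu0 nu_ge0 nu_sigma_additive.

End measure_instance.

(* A function on the cone is encoded by its extension by zero to the whole
   space, so that functions on the cone are equal iff their encodings are. *)
Definition restr_poly (p : mpoly.mpoly 3 R) : space -> R :=
  patch (fun=> 0) cone
    (fun z => mpoly.meval (fun i : 'I_3 => [:: z.1.1; z.1.2; z.2]`_i) p).

(* mpoly.msize p is the total degree plus one, and 0 if p = 0. *)
Definition Pi (m : nat) : set (space -> R) :=
  [set restr_poly p | p in [set p | (mpoly.msize p <= m.+1)%N]].

Definition PiC (m : nat) : set (space -> C) :=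
  [set f | exists2 g, Pi m g & exists2 h, Pi m h &
     f = (fun z => (g z +i* h z)%C)].

Record positive_cubature (N : nat) (xi : 'I_N -> space) (lam : 'I_N -> R) :
    Prop := PositiveCubature {
  cubature_inj : injective xi ;
  cubature_cone : forall j, cone (xi j) ;
  cubature_pos : forall j, 0 < lam j }.

Section L2.
Variables (gamma : R) (hgamma : -1 < gamma).
Local Notation nu := (cone_measure hgamma).

Definition exact_on (m N : nat) (xi : 'I_N -> space) (lam : 'I_N -> R) : Prop :=
  forall p, Pi m p ->
    (\sum_(j < N) lam j * p (xi j))%:E = (\int[nu]_(z in cone) (p z)%:E)%E.

Definition cintegral (f : space -> C) : C :=
  ((\int[nu]_(z in cone) complex.Re (f z)) +i*
   (\int[nu]_(z in cone) complex.Im (f z)))%C.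

Definition inner (f g : space -> C) : C :=
  cintegral (fun z => f z * (g z)^*).

Definition L2norm (f : space -> C) : \bar R :=
  Lnorm nu 2%:E (fun z => (normc (f z))%:E).

Definition orthonormal_basis (n D : nat) (P : 'I_D -> space -> C) : Prop :=
  [/\ forall l, PiC n (P l),
      forall k l, inner (P k) (P l) = (k == l)%:R
    & forall f, PiC n f ->
        exists c : 'I_D -> C, f = (fun z => \sum_(l < D) c l * P l z)].

Definition l2w_norm (N : nat) (lam : 'I_N -> R) (a : 'I_N -> C) : R :=
  Num.sqrt (\sum_(j < N) lam j * normc (a j) ^+ 2).

Definition opnorm (N : nat) (lam : 'I_N -> R)
    (T : ('I_N -> C) -> space -> C) : \bar R :=
  ereal_sup [set L2norm (T a) | a in [set a | l2w_norm lam a <= 1]].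

End L2.

Definition repr_kernel (D : nat) (P : 'I_D -> space -> C) (eta xi : space) : C :=
  \sum_(l < D) P l eta * (P l xi)^*.

Definition sampling_mx (N D : nat) (xi : 'I_N -> space) (lam : 'I_N -> R)
    (P : 'I_D -> space -> C) : 'M[C]_(N, D) :=
  \matrix_(j, l) ((Num.sqrt (lam j))%:C%C * P l (xi j)).

Definition synthesis (N : nat) (xi : 'I_N -> space) (lam : 'I_N -> R)
    (K : space -> space -> C) (a : 'I_N -> C) : space -> C :=
  fun z => \sum_(j < N) (lam j)%:C%C * a j * K z (xi j).

(* The Gram matrix of the smaller size is used, so that a matrix of size m x k
   has min(m, k) singular values counted with multiplicity. *)
Definition singular_value (m k : nat) (A : 'M[C]_(m, k)) : set R :=
  [set s | 0 <= s /\
     if (k <= m)%N then eigenvalue (A ^t* *m A) (s ^+ 2)%:C%C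
     else eigenvalue (A *m A ^t* ) (s ^+ 2)%:C%C].

(* The set of singular values is finite, so sup and inf are its maximum and
   minimum. *)
Definition kappa2 (m k : nat) (A : 'M[C]_(m, k)) : \bar R :=
  let smax := sup (singular_value A) in
  let smin := inf (singular_value A) in
  if smin == 0 then +oo%E else (smax / smin)%:E.

End cone.

(* Main.v *)
Require Import Defs.
From mathcomp Require Import all_boot all_order all_algebra complex.
From mathcomp Require mpoly.
(* Importing mpoly activates its canonical structures; its notations clash with
   those of the analysis library. *)
Import -(notations) mpoly.
From mathcomp Require Import all_classical all_reals all_analysis.
Import Order.TTheory GRing.Theory Num.Theory.
Local Open Scope ring_scope.
Local Open Scope sesquilinear_scope.

(**
  The products f * conj g of elements of PiC n have real and imaginary parts in
  Pi (2 n), so the cubature formula computes their L2 inner products exactly: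
  the map f |-> (sqrt lam_j f(xi_j))_j is an isometry. Its matrix in an
  orthonormal basis is S, hence S^* S = 1 and all singular values are 1. In
  these coordinates T followed by sampling is S S^*, an orthogonal projection,
  which gives norm at most 1; equality is attained on the samples of a basis
  function.
*)

(** * Closure properties of the polynomial spaces on the cone *)

Section polynomials.
Context {R : realType}.
Implicit Types (f g : space3 R -> R) (m k : nat).

Lemma PiD {m f g} : Pi m f -> Pi m g -> Pi m (fun z => f z + g z).
Proof.
move=> [p /= hp <-] [q /= hq <-]; exists (p + q) => /=.
  by rewrite (leq_trans (mpoly.msizeD_le _ _))// geq_max hp.
apply/funext => z; rewrite /restr_poly /patch.
by case: ifP => _; rewrite ?mpoly.mevalD ?addr0.
Qed.

Lemma PiZ {m} (c : R) {f} : Pi m f -> Pi m (fun z => c * f z).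
Proof.
move=> [p /= hp <-]; exists (c *: p) => /=.
  by rewrite (leq_trans (mpoly.msizeZ_le _ _)).
apply/funext => z; rewrite /restr_poly /patch.
by case: ifP => _; rewrite ?mpoly.mevalZ ?mulr0.
Qed.

Lemma PiB {m f g} : Pi m f -> Pi m g -> Pi m (fun z => f z - g z).
Proof.
move=> hf hg; rewrite (_ : (fun z => _) = fun z => f z + -1 * g z).
  exact: PiD hf (PiZ _ hg).
by apply/funext => z; rewrite mulN1r.
Qed.

Lemma PiM {m k f g} : Pi m f -> Pi k g -> Pi (m + k) (fun z => f z * g z).
Proof.
move=> [p /= hp <-] [q /= hq <-]; exists (p * q) => /=.
  (* Zero factors are split off because [msize] of a product is [msize p + msize q - 1], one more
     than the sum of the degrees, only for nonzero factors. *)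
  have [->|p0] := eqVneq p 0; first by rewrite mul0r mpoly.msize0.
  have [->|q0] := eqVneq q 0; first by rewrite mulr0 mpoly.msize0.
  rewrite mpoly.msizeM// -subn1 leq_subLR (leq_trans (leq_add hp hq))//.
  by rewrite addnS addSn.
apply/funext => z; rewrite /restr_poly /patch.
by case: ifP => _; rewrite ?mpoly.mevalM ?mulr0.
Qed.

Lemma Pi0 m : Pi m (fun _ : space3 R => 0 : R).
Proof.
exists 0; rewrite /= ?mpoly.msize0//.
by apply/funext => z; rewrite /restr_poly /patch mpoly.meval0 if_same.
Qed.

Lemma PiCP m (f : space3 R -> R[i]) :
  PiC m f <-> Pi m (fun z => complex.Re (f z)) /\ Pi m (fun z => complex.Im (f z)).
Proof.
split=> [[g hg [h hh ->]]//|[hre him]].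
exists (fun z => complex.Re (f z)) => //.
exists (fun z => complex.Im (f z)) => //.
by apply/funext => z; case: (f z).
Qed.

Lemma PiC_lincomb m D (c : 'I_D -> R[i]) (P : 'I_D -> space3 R -> R[i]) :
  (forall l, PiC m (P l)) -> PiC m (fun z => \sum_(l < D) c l * P l z).
Proof.
move=> hP; rewrite -(fct_sumE _ _ (fun l z => c l * P l z)).
apply: (big_ind (PiC m)) => [|f g|l _].
- by apply/PiCP; split; exact: Pi0.
- move=> /PiCP[f1 f2] /PiCP[g1 g2]; apply/PiCP; split.
  + rewrite (_ : (fun z => _) = fun z => complex.Re (f z) + complex.Re (g z)).
      exact: PiD.
    by apply/funext => z; rewrite fctE raddfD.
  + rewrite (_ : (fun z => _) = fun z => complex.Im (f z) + complex.Im (g z)).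
      exact: PiD.
    by apply/funext => z; rewrite fctE raddfD.
- have /PiCP[h1 h2] := hP l; apply/PiCP; split.
  + rewrite (_ : (fun z => _) = fun z =>
      complex.Re (c l) * complex.Re (P l z) - complex.Im (c l) * complex.Im (P l z)).
      exact: PiB (PiZ _ h1) (PiZ _ h2).
    by apply/funext => z; case: (c l) (P l z) => a b [x y].
  + rewrite (_ : (fun z => _) = fun z =>
      complex.Re (c l) * complex.Im (P l z) + complex.Im (c l) * complex.Re (P l z)).
      exact: PiD (PiZ _ h2) (PiZ _ h1).
    by apply/funext => z; case: (c l) (P l z) => a b [x y].
Qed.

End polynomials.

(** * Real and imaginary parts of products with a conjugate *)

Section complex_numbers.
Context {R : rcfType}.
Implicit Types z w : R[i].

Lemma sqr_normcE z : normc z ^+ 2 = complex.Re z ^+ 2 + complex.Im z ^+ 2.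
Proof. by case: z => x y; rewrite sqr_sqrtr// addr_ge0 ?sqr_ge0. Qed.

Lemma mulc_conj z : z * z^* = (normc z ^+ 2)%:C%C.
Proof. by rewrite -sqr_normc -[`|z|]/((normc z)%:C%C) rmorphXn. Qed.

Lemma ReMconj z w : complex.Re (z * w^*) =
  complex.Re z * complex.Re w + complex.Im z * complex.Im w.
Proof. by case: z w => [a b] [c d]; rewrite /= mulrN opprK. Qed.

Lemma ImMconj z w : complex.Im (z * w^*) =
  complex.Im z * complex.Re w - complex.Re z * complex.Im w.
Proof. by case: z w => [a b] [c d]; rewrite /= mulrN addrC. Qed.

End complex_numbers.

(** * Contraction property of the projection onto the range of an isometry *)

Section isometry.
Context {C : numClosedFieldType}.

Lemma trmxC_mul m n p (A : 'M[C]_(m, n)) (B : 'M[C]_(n, p)) :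
  (A *m B)^t* = B^t* *m A^t*.
Proof. by rewrite trmx_mul map_mxM. Qed.

Lemma sqr_norm_col n (v : 'cV[C]_n) :
  (v^t* *m v) 0 0 = \sum_(j < n) `|v j 0| ^+ 2.
Proof. by rewrite mxE; apply: eq_bigr => j _; rewrite !mxE normCK mulrC. Qed.

(** Since [S *m S^t*] is self-adjoint and idempotent, the image [w] of [v] satisfies
    [w^* w = v^* w = w^* v]. Hence the difference of the two sides is the squared norm of [v - w]
    (Pythagoras). *)
Lemma isometry_proj_le n d (S : 'M[C]_(n, d)) (v : 'cV[C]_n) :
  S^t* *m S = 1%:M ->
  \sum_(j < n) `|(S *m (S^t* *m v)) j 0| ^+ 2 <= \sum_(j < n) `|v j 0| ^+ 2.
Proof.
move=> hS; rewrite -!sqr_norm_col; set w := S *m _.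
have hww : w^t* *m w = v^t* *m w.
  by rewrite /w !trmxC_mul trmxCK -!mulmxA (mulmxA (S^t*) S) hS mul1mx.
have hwv : w^t* *m v = w^t* *m w.
  by rewrite hww /w !trmxC_mul trmxCK !mulmxA.
rewrite -subr_ge0.
suff -> : (v^t* *m v) 0 0 - (w^t* *m w) 0 0 = ((v - w)^t* *m (v - w)) 0 0.
  by rewrite sqr_norm_col sumr_ge0// => j _; rewrite exprn_ge0.
have -> : (v - w)^t* = v^t* - w^t*.
  by apply/matrixP => i j; rewrite !mxE rmorphB.
rewrite mulmxBl !mulmxBr hwv hww subrr subr0.
by rewrite [RHS]mxE [X in _ = _ + X]mxE.
Qed.

End isometry.

(** * Condition number of an isometry *)

Section singular_values.
Context {R : realType}.

(** A rank count gives [k <= m], so the relevant Gram matrix is the identity and 1 is the only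
    singular value. An eigenvector exists because [0 < k]. *)
Lemma kappa2_isometry m k (A : 'M[R[i]]_(m, k)) :
  (0 < k)%N -> A^t* *m A = 1%:M -> kappa2 A = 1%E.
Proof.
move=> k0 hA; have km := mulmx1_min hA.
have hs : singular_value A = [set 1]%classic.
  apply/seteqP; split => s /=; rewrite /singular_value/= km hA.
    move=> [s0 /eigenvalueP[v]]; rewrite mulmx1 => hv v0.
    have /eqP : (1 - (s ^+ 2)%:C%C) *: v = 0.
      by rewrite scalerBl scale1r -hv subrr.
    rewrite scaler_eq0 (negPf v0) orbF subr_eq0 => /eqP[/esym/eqP].
    by rewrite sqrp_eq1// => /eqP.
  move=> ->; split => //; apply/eigenvalueP.
  (* Any nonzero row is an eigenvector of the identity. *)
  exists (const_mx 1); first by rewrite mulmx1 expr1n scale1r.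
  apply/eqP => /matrixP /(_ 0 (Ordinal k0)); rewrite !mxE => /eqP.
  by rewrite oner_eq0.
by rewrite /kappa2 hs sup1 inf1 oner_eq0 divr1.
Qed.

End singular_values.

(** * Discretization of the inner product and the norm *)

Section cubature.
Context {R : realType} {gamma : R} (hgamma : -1 < gamma).
Context {n N : nat} {xi : 'I_N -> space3 R} {lam : 'I_N -> R}.
Hypothesis cub : positive_cubature xi lam.
Hypothesis exact_cub : exact_on hgamma (2 * n) xi lam.
Local Notation L2norm := (L2norm hgamma).
Local Notation inner := (inner hgamma).

Let lam_ge0 j : 0 <= lam j.
Proof. exact: ltW (cubature_pos cub j). Qed.

Lemma cubature_Rintegral p : Pi (2 * n) p ->
  (\int[cone_measure hgamma]_(z in cone) p z)%R = \sum_(j < N) lam j * p (xi j).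
Proof. by move=> /exact_cub hp; rewrite /Rintegral -hp. Qed.

Lemma cubature_inner f g : PiC n f -> PiC n g ->
  inner f g = \sum_(j < N) (lam j)%:C%C * (f (xi j) * (g (xi j))^*).
Proof.
move=> /PiCP[f1 f2] /PiCP[g1 g2].
have hre : Pi (2 * n) (fun z => complex.Re (f z * (g z)^*)).
  rewrite mul2n -addnn; under eq_fun do rewrite ReMconj.
  exact: PiD (PiM _ _) (PiM _ _).
have him : Pi (2 * n) (fun z => complex.Im (f z * (g z)^*)).
  rewrite mul2n -addnn; under eq_fun do rewrite ImMconj.
  exact: PiB (PiM _ _) (PiM _ _).
rewrite /Defs.inner /cintegral !cubature_Rintegral//.
have hC (a : R) (z : R[i]) : a%:C%C * z = (a * complex.Re z +i* (a * complex.Im z))%C.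
  by case: z => x y; congr Complex; rewrite /= mul0r ?subr0 ?addr0.
apply/eqP; rewrite eq_complex !raddf_sum /=.
by apply/andP; split; apply/eqP/eq_bigr => j _; rewrite hC.
Qed.

Lemma cubature_L2norm_sqr p : PiC n p ->
  (\sum_(j < N) lam j * normc (p (xi j)) ^+ 2)%:E = (L2norm p ^+ 2)%E.
Proof.
move=> /PiCP[p1 p2].
have hp : Pi (2 * n) (fun z => normc (p z) ^+ 2).
  rewrite mul2n -addnn; under eq_fun do rewrite sqr_normcE !expr2.
  exact: PiD (PiM _ _) (PiM _ _).
rewrite (exact_cub _ hp) integral_mkcond.
have L0 : (0 <= L2norm p)%E by exact: Lnorm_ge0.
(* The square is turned into a real power, the form in which [Lnorm] unfolds to an integral. *)
have -> : (L2norm p ^+ 2 = L2norm p `^ 2)%E.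
  by rewrite expe2 -[2]/(1 + 1) poweRD ?poweRe1// add_neq0_poweRD_def.
rewrite poweR_Lnorm//; apply: eq_integral => z _.
have pz0 : 0 <= normc (p z) by case: (p z) => *; exact: sqrtr_ge0.
rewrite gee0_abs ?lee_fin// poweR_EFin powR_mulrn// /patch; case: ifPn => // nz.
(* The norm integrates over the whole space and exactness only over the cone; off the cone the
   integrand vanishes by the extension by zero. *)
case: hp => q _ /(congr1 (fun f => f z)) <-.
by rewrite /restr_poly /patch (negPf nz).
Qed.

Lemma L2normE p : PiC n p ->
  L2norm p = (l2w_norm lam (fun j => p (xi j)))%:E.
Proof.
move=> /cubature_L2norm_sqr; rewrite /l2w_norm.
have : (0 <= L2norm p)%E by exact: Lnorm_ge0.
(* Infinite values are excluded by nonnegativity and by the finite value of the square. *)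
case: (L2norm p) => [r||]//; rewrite ?lee_fin => r0.
by rewrite expe2 -EFinM => -[->]; rewrite -expr2 sqrtr_sqr ger0_norm.
Qed.

(** * Sampling matrix and synthesis operator in an orthonormal basis *)

Context {D : nat} {P : 'I_D -> space3 R -> R[i]}.
Hypothesis orthP : orthonormal_basis hgamma n P.
Local Notation S := (sampling_mx xi lam P).
Local Notation T := (synthesis xi lam (repr_kernel P)).

Let PP l : PiC n (P l). Proof. by case: orthP. Qed.

Let sqrt_lamK j : (Num.sqrt (lam j))%:C%C * (Num.sqrt (lam j))%:C%C = (lam j)%:C%C.
Proof. by rewrite -rmorphM -expr2 sqr_sqrtr. Qed.

Let sqrt_lamJ j : (Num.sqrt (lam j))%:C%C^* = (Num.sqrt (lam j))%:C%C.
Proof. exact: conjc_real. Qed.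

Lemma cubature_orthonormal k l :
  \sum_(j < N) (lam j)%:C%C * (P k (xi j) * (P l (xi j))^*) = (k == l)%:R.
Proof. by rewrite -cubature_inner//; case: orthP. Qed.

Lemma sampling_isometry : S^t* *m S = 1%:M.
Proof.
apply/matrixP => k l; rewrite !mxE eq_sym -cubature_orthonormal.
apply: eq_bigr => j _; rewrite !mxE rmorphM/= sqrt_lamJ -sqrt_lamK.
by rewrite mulrACA [X in _ * X]mulrC.
Qed.

(** Expanding the kernel and exchanging the sums exhibits the coordinates of [T a] in the basis [P],
    which are the entries of [S^t* *m weighted a]. *)
Lemma synthesisE a : T a = fun z =>
  \sum_(l < D) (\sum_(j < N) (lam j)%:C%C * (a j * (P l (xi j))^*)) * P l z.
Proof.
apply/funext => z; rewrite /synthesis /repr_kernel.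
under eq_bigr do rewrite mulr_sumr.
rewrite exchange_big; apply: eq_bigr => l _; rewrite mulr_suml.
by apply: eq_bigr => j _; rewrite -!mulrA [P l z * _]mulrC.
Qed.

Lemma PiC_synthesis a : PiC n (T a).
Proof. by rewrite synthesisE; exact: PiC_lincomb. Qed.

(** Discrete orthonormality leaves a single nonzero coordinate. This provides the extremal vector
    for the norm of [T]. *)
Lemma synthesis_basis k : T (fun j => P k (xi j)) = P k.
Proof.
rewrite synthesisE; apply/funext => z; under eq_bigr do rewrite cubature_orthonormal.
rewrite (bigD1 k)//= eqxx mul1r big1 ?addr0// => l lk.
by rewrite eq_sym (negPf lk) mul0r.
Qed.

(** Carries the weighted norm [l2w_norm lam] to the Euclidean norm, where the matrix inequality
    applies. *)
Let weighted (a : 'I_N -> R[i]) : 'cV[R[i]]_N :=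
  \col_j ((Num.sqrt (lam j))%:C%C * a j).

Let sum_weighted a : \sum_(j < N) `|weighted a j 0| ^+ 2 =
  (\sum_(j < N) lam j * normc (a j) ^+ 2)%:C%C.
Proof.
rewrite rmorph_sum/=; apply: eq_bigr => j _.
by rewrite mxE normCK rmorphM/= mulrACA sqrt_lamJ sqrt_lamK mulc_conj -rmorphM.
Qed.

Lemma sampling_synthesis a :
  S *m (S^t* *m weighted a) = weighted (fun j => T a (xi j)).
Proof.
apply/matrixP => j i; rewrite !mxE synthesisE mulr_sumr; apply: eq_bigr => l _.
rewrite !mxE -mulrA; congr (_ * _); rewrite mulrC; congr (_ * _).
apply: eq_bigr => k _; rewrite !mxE rmorphM/= sqrt_lamJ -sqrt_lamK.
by rewrite mulrACA [X in _ * X]mulrC.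
Qed.

Lemma l2w_norm_synthesis_le a :
  l2w_norm lam (fun j => T a (xi j)) <= l2w_norm lam a.
Proof.
apply: ler_wsqrtr; rewrite -lecR -!sum_weighted -sampling_synthesis.
exact: isometry_proj_le sampling_isometry.
Qed.

Lemma opnorm_synthesis : (0 < D)%N -> opnorm hgamma lam T = 1%E.
Proof.
move=> D0; apply/eqP; rewrite eq_le; apply/andP; split.
  apply: ge_ereal_sup => _ [a /= a1 <-].
  (* As [T a] is again a polynomial, its norm can be read off from its samples. *)
  rewrite L2normE; last exact: PiC_synthesis.
  by rewrite lee_fin (le_trans (l2w_norm_synthesis_le a)).
pose k := Ordinal D0.
have hk : l2w_norm lam (fun j => P k (xi j)) = 1.
  rewrite /l2w_norm; set s := \sum_(_ < _) _.
  suff -> : s = 1 by rewrite sqrtr1.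
  (* Discrete orthonormality is an identity in [R[i]], so the real sum is compared with 1 there. *)
  apply: (@complexI R); rewrite rmorph_sum rmorph1/=.
  have := cubature_orthonormal k k; rewrite eqxx mulr1n => <-.
  by apply: eq_bigr => j _; rewrite mulc_conj -rmorphM.
apply: ereal_sup_ubound; exists (fun j => P k (xi j)) => /=.
  by rewrite hk.
by rewrite synthesis_basis L2normE// hk.
Qed.

End cubature.

Theorem proposition4p6 (R : realType) (gamma : R) (hgamma : -1 < gamma)
    (n N : nat) (xi : 'I_N -> space3 R) (lam : 'I_N -> R) :
  positive_cubature xi lam -> exact_on hgamma (2 * n) xi lam ->
  (forall p : space3 R -> R[i], PiC n p ->
     (\sum_(j < N) lam j * normc (p (xi j)) ^+ 2)%:E
       = (L2norm hgamma p ^+ 2)%E) /\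
  (forall P : 'I_((n + 1) ^ 2) -> space3 R -> R[i],
     orthonormal_basis hgamma n P ->
     [/\ (sampling_mx xi lam P) ^t* *m sampling_mx xi lam P = 1%:M,
         kappa2 (sampling_mx xi lam P) = 1%E
       & opnorm hgamma lam (synthesis xi lam (repr_kernel P)) = 1%E]).
Proof.
move=> cub exact_cub; split=> [p|P orthP].
  exact: cubature_L2norm_sqr.
(* A nonempty basis supplies both an eigenvector of the Gram matrix and a unit vector attaining the
   norm of [T]. *)
have D0 : (0 < (n + 1) ^ 2)%N by rewrite expn_gt0 addn1.
have hS := sampling_isometry hgamma cub exact_cub orthP.
split=> //; first exact: kappa2_isometry.
exact: (opnorm_synthesis hgamma cub exact_cub orthP D0).
Qed.
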